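(* Let $(a_n)_{n\in\omega}$ be an increasing sequence in $\omega$ such that $a_0\geq 2$ and $a_{n+1}>2a_n$ for all $n\in\omega$. Then $\bigcup_{n\in\omega}\mathrm{L}(a_n)$ is not $2$-lineable.
   Context: $\ell_\infty$ is the real Banach space of bounded real sequences $x=(x(n))_{n\in\omega}$, where $\omega=\{0,1,2,\dots\}$. For $x\in\ell_\infty$, a real $\eta$ is an accumulation point of $x$ if $\{n\in\omega: |x(n)-\eta|<\varepsilon\}$ is infinite for all $\varepsilon>0$; $\mathrm{L}_x$ denotes the set of accumulation points of $x$. For a cardinal $\kappa$, $\mathrm{L}(\kappa)=\{x\in\ell_\infty: |\mathrm{L}_x|=\kappa\}$. A subset $M$ of a vector space $X$ is $\kappa$-lineable, for a cardinal $\kappa$, if $M\cup\{0\}$ contains a linear subspace of $X$ of dimension $\kappa$. *)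

(* Defs.v *)
From HB Require Import structures.
From mathcomp Require Import all_boot all_order all_algebra.
From mathcomp Require Import all_classical all_reals all_analysis.

Set Implicit Arguments.
Unset Strict Implicit.
Unset Printing Implicit Defensive.

Import Order.TTheory GRing.Theory Num.Theory.
Import numFieldNormedType.Exports.

Local Open Scope classical_set_scope.
Local Open Scope card_scope.
Local Open Scope ring_scope.

(* Cardinal numbers are represented by sets [K : set J] up to equipotence
   [#=]; the finite cardinal [n] is represented by [`I_n] = {0, ..., n-1}. *)

Section LinearSubspaces.
Context (F : fieldType) (X : lmodType F).

Definition lin_indep (B : set X) : Prop :=
  forall (s : seq X) (c : X -> F), uniq s -> [set` s] `<=` B ->
    \sum_(v <- s) c v *: v = 0 -> {in s, forall v, c v = 0}.

Definition lin_span (B : set X) : set X :=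
  [set u | exists (s : seq X) (c : X -> F),
     [set` s] `<=` B /\ u = \sum_(v <- s) c v *: v].

Definition is_subspace (V : set X) : Prop := GRing.submod_closed (mem V).

Definition has_dim (J : Type) (K : set J) (V : set X) : Prop :=
  exists B : set X, [/\ lin_indep B, lin_span B = V & B #= K].

Definition lineable (J : Type) (K : set J) (M : set X) : Prop :=
  exists V : set X,
    [/\ is_subspace V, has_dim K V & V `<=` M `|` [set 0]].

End LinearSubspaces.

Section BoundedSequences.
Context (R : realType).

Definition bounded_seq : {pred nat -> R} :=
  mem [set x : nat -> R | bounded_fun x].

Lemma bounded_seqP (x : nat -> R) :
  reflect (exists M : R, forall n, `|x n| <= M) (x \in bounded_seq).
Proof.
apply: (iffP idP) => [|[M xM]]; rewrite inE /=.
- move=> [M [_ xM]]; exists (M + 1) => n.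
  by apply: (xM (M + 1)) => //; rewrite ltrDl.
- exists M; split; first exact: num_real.
  by move=> N /ltW MN n _; exact: le_trans (xM n) MN.
Qed.

Lemma bounded_seq_submod_closed : GRing.submod_closed bounded_seq.
Proof.
split; first by apply/bounded_seqP; exists 0 => n; rewrite normr0.
move=> a x y /bounded_seqP[M xM] /bounded_seqP[N yN].
apply/bounded_seqP; exists (`|a| * M + N) => n.
rewrite (le_trans (ler_normD _ _))// lerD// normrM.
by rewrite ler_wpM2l.
Qed.

HB.instance Definition _ :=
  GRing.isSubmodClosed.Build R (nat -> R) bounded_seq bounded_seq_submod_closed.

(* l_infty as a real vector space; its sup norm plays no role. *)
Record linf : Type := Linf {
  linf_val :> nat -> R;
  linf_valP : linf_val \in bounded_seq }.

HB.instance Definition _ := [isSub for linf_val].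
HB.instance Definition _ := [Choice of linf by <:].
HB.instance Definition _ := [SubChoice_isSubLmodule of linf by <:].

Definition accumulation_points (x : linf) : set R :=
  [set eta | forall eps : R, 0 < eps ->
     infinite_set [set n : nat | `|x n - eta| < eps]].

Definition Lcard (J : Type) (K : set J) : set linf :=
  [set x | accumulation_points x #= K].

End BoundedSequences.

Arguments Lcard R {J} K.

(* Main.v *)
(* Let [u, v] span the plane and let [K] be the finite set of joint accumulation
   points of [(u, v)] in [R * R], so that the accumulation points of
   [c *: u + d *: v] form the image of [K] under the linear form [(c, d)]. Every
   nonzero form thus takes [a n] values on [K] for some [n]. Consider the slopes
   [t] at which [x + t y] collapses two points of [K]. There are at least two of
   them, since otherwise some nonzero form would be constant on [K]. Let [g] and
   [h] be the forms at two consecutive slopes. Between these slopes the forms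
   order [K] in the same way, and no pair of neighbours in this order is
   collapsed by both [g] and [h]; hence [#|g K| + #|h K| > #|K|]. But [g + h] is
   injective on [K], so [#|K| = a m] for some [m], while [#|g K|] and [#|h K|]
   are smaller terms of the sequence, hence each is less than [a m / 2]. *)
Require Import Defs.
From mathcomp Require Import all_boot all_order all_algebra.
From mathcomp Require Import all_classical all_reals all_analysis.
From mathcomp Require Import finmap ring lra zify.

Set Implicit Arguments. Unset Strict Implicit. Unset Printing Implicit Defensive.
Import Order.TTheory GRing.Theory Num.Theory.
Local Open Scope ring_scope.

(** * Counting the values of two functions along a common order *)

Lemma size_undup_min_cons (R : realDomainType) (x y : R) (s : seq R) :
    x <= y -> {in s, forall z, y <= z} ->
  size (undup (x :: y :: s)) = ((x != y) + size (undup (y :: s)))%N.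
Proof.
move=> xy ys; have [->|neq_xy] := eqVneq x y; first by rewrite /= mem_head.
suff /negPf xNs : x \notin y :: s by rewrite [undup _]/= xNs.
rewrite inE negb_or neq_xy; apply: contraL isT => /ys yx.
by rewrite eq_le xy yx in neq_xy.
Qed.

(** The last point gives one value of [g] and one of [h]. Each point put in front of it is minimal
    for both functions and adds a new value of at least one, whence the strict inequality. *)
Lemma pairwise_size_undup_map (R : realDomainType) (T : eqType)
    (g h : T -> R) (s : seq T) :
    (0 < size s)%N ->
    pairwise (fun p q => [&& g p <= g q, h p <= h q &
                          (g p != g q) || (h p != h q)]) s ->
  (size s < size (undup (map g s)) + size (undup (map h s)))%N.
Proof.
elim: s => // p [_ _ _ //|q s] /(_ isT) IH _; rewrite pairwise_cons => /andP[].
move=> /andP[/and3P[gpq hpq nepq] _] /[dup] /IH {}IH.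
rewrite pairwise_cons => /andP[/allP hq _].
have hg : {in map g s, forall z, g q <= z}.
  by move=> _ /mapP[r /hq /and3P[? _ _] ->].
have hh : {in map h s, forall z, h q <= z}.
  by move=> _ /mapP[r /hq /and3P[_ ? _] ->].
move: IH; rewrite ![map _ (_ :: _ :: _)]/= !size_undup_min_cons//.
rewrite ![map _ (_ :: _)]/= ![size (_ :: _)]/=.
by move: nepq; case: (g p != g q); case: (h p != h q) => //= _; lia.
Qed.

(* If no two points are exchanged between the orders of [s] by [g] and by [h],
   list [s] along the common order: each of the [size s - 1] adjacent pairs is
   separated by [g] or by [h]. *)
Lemma size_undup_map_comonotone (R : realDomainType) (T : eqType)
    (g h : T -> R) (s : seq T) :
    uniq s -> (0 < size s)%N ->
    {in s &, forall p q, 0 <= (g p - g q) * (h p - h q)} ->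
    {in s &, forall p q, g p = g q -> h p = h q -> p = q} ->
  (size s < size (undup (map g s)) + size (undup (map h s)))%N.
Proof.
move=> us s0 gh inj; pose le p q := (g p <= g q) && (h p <= h q).
have le_total : {in s &, total le}.
  move=> p q ps qs; have := gh p q ps qs; rewrite /le.
  have [gpq|gqp|->] := ltgtP (g p) (g q); last by rewrite /= le_total.
    by rewrite nmulr_rge0 ?subr_lt0// subr_le0 /= orbF.
  by rewrite pmulr_rge0 ?subr_gt0// subr_ge0.
have le_trans : transitive le.
  move=> q p r /andP[gpq hpq] /andP[gqr hqr].
  by rewrite /le (le_trans gpq gqr) (le_trans hpq hqr).
pose t := sort le s; have st : perm_eq t s by rewrite perm_sort.
have ut : uniq t by rewrite sort_uniq.
have mt := perm_mem st.
have lt : pairwise le t.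
  by rewrite -sorted_pairwise// (sort_sorted_in le_total)//; apply/allP.
have size_t (f : T -> R) : size (undup (map f t)) = size (undup (map f s)).
  by apply/perm_size/perm_undup => z; apply/perm_mem/perm_map.
rewrite -!size_t -(perm_size st) pairwise_size_undup_map ?(perm_size st)//.
have : pairwise [rel p q | (p != q) && le p q] t.
  by rewrite pairwise_relI -uniq_pairwise ut.
apply: (@sub_in_pairwise _ (mem s)); last by apply/allP => p; rewrite /= mt.
move=> p q ps qs /= /andP[npq /andP[-> ->]] /=.
by rewrite -negb_and; apply: contra npq => /andP[/eqP gpq /eqP hpq];
  apply/eqP/inj.
Qed.

(** * Linear forms on a finite set of points in the plane *)

Lemma no_planar_gap_spectrum (R : realFieldType) (a : nat -> nat)
    (a_incr : forall m n : nat, (m < n)%N -> (a m < a n)%N)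
    (a0_ge2 : (2 <= a 0)%N)
    (a_gap : forall n : nat, (2 * a n < a n.+1)%N) (s : seq (R * R)) :
    uniq s ->
  ~ forall c d : R, (c != 0) || (d != 0) ->
    exists n, size (undup [seq c * p.1 + d * p.2 | p <- s]) = a n.
Proof.
move=> us spec.
have a_ge2 n : (2 <= a n)%N.
  by case: n => [//|n]; apply: leq_trans a0_ge2 (ltnW (a_incr _ _ _)).
have gap m n : (a m < a n)%N -> (2 * a m < a n)%N.
  move=> amn; have mn : (m < n)%N.
    rewrite ltnNge leq_eqVlt; apply/negP => /orP[/eqP nm|/a_incr].
      by rewrite nm ltnn in amn.
    by rewrite ltnNge ltnW.
  apply: leq_trans (a_gap m) _; move: mn; rewrite leq_eqVlt.
  by case/orP => [/eqP->//|/a_incr /ltnW].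
pose f (t : R) (p : R * R) := p.1 + t * p.2.
have fspec t : exists n, size (undup (map (f t) s)) = a n.
  have [|n an] := spec 1 t; first by rewrite oner_neq0.
  by exists n; rewrite -an; congr (size (undup _)); apply: eq_map => p;
     rewrite mul1r.
have s_gt0 : (0 < size s)%N.
  have [n fn] := fspec 0; case: (s) fn => //= an0.
  by have := a_ge2 n; rewrite -an0.
have not_cst (h : R * R -> R) c : (exists n, size (undup (map h s)) = a n) ->
    ~ {in s, forall p, h p = c}.
  move=> [n hn] hc; have := a_ge2 n; rewrite -hn leqNgt ltnS => /negP; apply.
  apply: (uniq_leq_size (s2 := [:: c])) (undup_uniq _) _ => x.
  by rewrite mem_undup inE => /mapP[p /hc-> ->].
have [p0 p0s] : exists p, p \in s.
  by case: (s) s_gt0 => // p s' _; exists p; apply: mem_head.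
(* The form [(0, 1)] takes at least two values, so at least one slope exists. *)
have [q0 q0s neq0] : exists2 q, q \in s & q.2 != p0.2.
  have [/hasP//|/hasPn eq_snd] := boolP (has (fun q => q.2 != p0.2) s).
  have [|n an] := spec 0 1; first by rewrite oner_neq0 orbT.
  case: (not_cst snd p0.2); last by move=> p /eq_snd /negPn /eqP.
  exists n; rewrite -an; congr (size (undup _)); apply: eq_map => p.
  by rewrite mul0r mul1r add0r.
(* The only [t] with [f t p = f t q], hence the only place where [f t p - f t q] can change sign. *)
pose slope (p q : R * R) := - (p.1 - q.1) / (p.2 - q.2).
have f_slope t p q : p.2 != q.2 ->
    f t p - f t q = (t - slope p q) * (p.2 - q.2).
  by rewrite -subr_eq0 /f /slope => npq; field.
pose T := sort <=%O (undup [seq slope pq.1 pq.2 |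
  pq <- [seq pq <- allpairs pair s s | pq.1.2 != pq.2.2]]).
have slopeT p q : p \in s -> q \in s -> p.2 != q.2 -> slope p q \in T.
  move=> ps qs npq; rewrite mem_sort mem_undup.
  by apply/mapP; exists (p, q) => //; rewrite mem_filter npq allpairs_f.
(* If [f t] identifies [p] and [q], then removing [q] from [s] does not change the image. *)
have collapse t : t \in T -> (size (undup (map (f t) s)) < size s)%N.
  rewrite mem_sort mem_undup => /mapP[[p q]].
  rewrite mem_filter => /andP[/= npq /allpairsP[[p' q'] /= [ps qs]]].
  move=> [pp qq] tE; subst p' q'.
  have fpq : f t q = f t p.
    by apply/esym/eqP; rewrite -subr_eq0 f_slope// -tE subrr mul0r.
  have p_rem : p \in rem q s.
    by rewrite mem_rem_uniq// inE /= ps andbT; apply: contra npq => /eqP->.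
  apply: leq_ltn_trans (_ : (size (map (f t) (rem q s)) < _)%N); last first.
    by rewrite size_map size_rem// prednK.
  apply: uniq_leq_size (undup_uniq _) _ => _ /[!mem_undup] /mapP[r rs ->].
  have [->|nrq] := eqVneq r q; first by rewrite fpq map_f.
  by rewrite map_f// mem_rem_uniq// inE /= nrq.
have sT : sorted <=%O T by apply: sort_le_sorted.
have uT : uniq T by rewrite sort_uniq undup_uniq.
have := slopeT _ _ q0s p0s neq0.
(* If [t1] were the only slope, [f t1] would agree on any two points with distinct second
   coordinates. A point level with [p0] is compared to it through [q0], so [f t1] would be constant
   on [s]. *)
case: T sT uT slopeT collapse => [//|t1 [|t2 T]].
  move=> _ _ slopeT _ _; apply: (not_cst (f t1) (f t1 p0)) => //.
  have eqf p q : p \in s -> q \in s -> p.2 != q.2 -> f t1 p = f t1 q.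
    move=> ps qs npq; have := slopeT p q ps qs npq; rewrite inE => /eqP slp.
    by apply/eqP; rewrite -subr_eq0 f_slope// slp subrr mul0r.
  move=> r rs; have [rp|] := eqVneq r.2 p0.2; last exact: eqf.
  by rewrite (eqf r q0) ?(eqf q0 p0)// rp eq_sym.
move=> /=; rewrite inE negb_or le_path_sortedE.
move=> /andP[t12 /andP[/allP t2T _]] /andP[/andP[nt12 _] _] slopeT collapse _.
have {nt12}t12 : t1 < t2 by rewrite lt_neqAle nt12.
(* For points on the same level the difference does not depend on [t]. Otherwise the sign is that of
   [(t1 - slope p q) * (t2 - slope p q)], and no slope lies strictly between [t1] and [t2]. *)
have comono : {in s &, forall p q, 0 <= (f t1 p - f t1 q) * (f t2 p - f t2 q)}.
  move=> p q ps qs; have [pq|npq] := eqVneq p.2 q.2.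
    have fE t : f t p - f t q = p.1 - q.1 by rewrite /f pq; ring.
    by rewrite !fE -expr2 sqr_ge0.
  rewrite !f_slope// mulrACA -expr2 mulr_ge0 ?sqr_ge0//.
  have := slopeT p q ps qs npq; rewrite inE => /predU1P[->|].
    by rewrite subrr mul0r.
  rewrite inE => slT; have {slT}slT : t2 <= slope p q.
    by case/predU1P: slT => [->//|/t2T].
  by apply: mulr_le0; rewrite subr_le0// ltW// (lt_le_trans t12).
have inj : {in s &, forall p q, f t1 p = f t1 q -> f t2 p = f t2 q -> p = q}.
  move=> [p1 p2] [q1 q2] _ _; rewrite /f /= => e1 e2.
  have : (t2 - t1) * (p2 - q2) = 0 by lra.
  move=> /eqP; rewrite mulf_eq0 !subr_eq0 (gt_eqF t12) /= => /eqP p2q2.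
  by move: e1; rewrite p2q2 => /addIr ->.
(* The coefficients [2] and [t1 + t2] are those of [f t1 + f t2]. By [comono] the two differences
   never have opposite signs, so their sum vanishes only if both do. *)
have [m sm] : exists m, size s = a m.
  have [|m am] := spec 2 (t1 + t2); first by rewrite pnatr_eq0.
  exists m; rewrite -am undup_id ?size_map// map_inj_in_uniq// => p q ps qs e.
  have e0 : f t1 p - f t1 q = - (f t2 p - f t2 q) by rewrite /f; lra.
  have := comono p q ps qs; rewrite e0 mulNr oppr_ge0 -expr2 => le0.
  have /eqP : (f t2 p - f t2 q) ^+ 2 = 0 by apply/le_anti; rewrite le0 sqr_ge0.
  rewrite sqrf_eq0 => /eqP z; move: e0; rewrite z oppr0.
  by move=> /subr0_eq e1; move/subr0_eq: z => e2; apply: inj.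
have := size_undup_map_comonotone us s_gt0 comono inj.
have := collapse t1; have := collapse t2; rewrite !inE !eqxx orbT.
have [i ->] := fspec t1; have [j ->] := fspec t2; rewrite sm.
by move=> /(_ isT) /gap gj /(_ isT) /gap gi; lia.
Qed.

(** * Accumulation points as limits along free ultrafilters *)

Import numFieldNormedType.Exports.
Local Open Scope classical_set_scope.
Local Open Scope card_scope.

Lemma card_eq_seq_undup (T : choiceType) (s : seq T) n :
  [set` s] #= `I_n -> size (undup s) = n.
Proof.
have -> : [set` s] = [set` seq_fset tt s].
  by apply/funext => x; rewrite /mkset seq_fsetE.
by move=> /card_eq_fsetP; rewrite size_seq_fset.
Qed.

Section AccumulationPoints.
Context (R : realType).
Implicit Types (u v : linf R) (U : set_system nat).

Lemma accumulation_pointsP u (x : R) :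
  accumulation_points u x <->
  exists U, [/\ UltraFilter U, \oo `<=` U & u n @[n --> U] --> x].
Proof.
split=> [ux|[U [UU ooU ux]] eps eps0 fin]; last first.
  have /finite_seqP[s sE] := fin.
  have Us : U (~` [set` s]).
    apply: ooU; exists (\max_(i <- s) i).+1 => // n /= sn ns.
    by move: sn; rewrite ltnNge leq_bigmax_seq.
  have Uu : U [set` s].
    rewrite -sE; move/cvgrPdist_lt : ux => /(_ _ eps0).
    by apply: filterS => n /=; rewrite distrC.
  by have [n []] := filter_ex (filterI Us Uu).
(* The bound on [i.1] forces convergence to [x], and the one on [i.2] makes the generated filter
   contain all cofinite sets. *)
pose B (i : R * nat) := [set n | `|u n - x| < i.1 /\ (i.2 <= n)%N].
have FF : ProperFilter (filter_from [set i : R * nat | 0 < i.1] B).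
  apply: filter_from_proper; first apply: filter_from_filter.
  - by exists (1, 0%N) => /=.
  - move=> [e m] [e' m'] /= e0 e'0; exists (Num.min e e', maxn m m') => /=.
      by rewrite lt_min e0.
    by move=> n [/=]; rewrite lt_min geq_max => /andP[? ?] /andP[].
  - move=> [e m] /= e0.
    have : infinite_set ([set n | `|u n - x| < e] `\` `I_m).
      by apply: infinite_setD; [exact: ux|exact: finite_II].
    move=> /infinite_setN0[n [/= une /negP]]; rewrite -leqNgt => mn.
    by exists n.
have [U [UU FU]] := ultraFilterLemma FF.
exists U; split=> //.
  move=> A [m _ mA]; apply: FU; exists (1, m) => //= n [_ /=]; exact: mA.
apply/cvgrPdist_lt => e e0; apply: FU; exists (e, 0%N) => //= n [+ _].
by rewrite distrC.
Qed.

(** By compactness of [[-M, M]] the image of [U] has a cluster point, and an ultrafilter converges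
    to each of its cluster points. *)
Lemma bounded_ultra_cvg (u : linf R) U :
  UltraFilter U -> exists x : R, u n @[n --> U] --> x.
Proof.
move=> UU; have /bounded_seqP[M uM] := linf_valP u.
have [|x [_ ux]] := @segment_compact R (- M) M (u n @[n --> U]) _.
  by apply: (@filterE _ U) => n; rewrite /= in_itv /= -ler_norml.
exists x => A /= xA; have [//|UA] := in_ultra_setVsetC (u @^-1` A) UU.
by have [y []] := ux (~` A) A UA xA.
Qed.

(** One ultrafilter serves both coordinates: these are the accumulation points of the planar
    sequence [(u n, v n)], in general fewer than the pairs of separate ones. *)
Definition joint_accumulation_points u v : set (R * R) :=
  [set p | exists U, [/\ UltraFilter U, \oo `<=` U,
    u n @[n --> U] --> p.1 & v n @[n --> U] --> p.2]].

(** An ultrafilter along which the combination converges also gives limits to the bounded sequences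
    [u] and [v], so no accumulation point of the combination is missed. *)
Lemma accumulation_points_lincomb u v (c d : R) :
  accumulation_points (c *: u + d *: v) =
  [set c * p.1 + d * p.2 | p in joint_accumulation_points u v].
Proof.
have cvg_lincomb U (x y : R) : Filter U ->
    u n @[n --> U] --> x -> v n @[n --> U] --> y ->
    (c *: u + d *: v : linf R) n @[n --> U] --> c * x + d * y.
  by move=> UU ux vy; apply: cvgD; apply: cvgM => //; exact: cvg_cst.
apply/seteqP; split=> [z|_ [p [U [UU ooU up vp]] <-]];
  first move=> /accumulation_pointsP[U [UU ooU wz]].
  have [x ux] := bounded_ultra_cvg u UU; have [y vy] := bounded_ultra_cvg v UU.
  exists (x, y); first by exists U.
  exact: cvg_unique (cvg_lincomb _ _ _ _ ux vy) wz.
by apply/accumulation_pointsP; exists U; split=> //; exact: cvg_lincomb.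
Qed.

Lemma finite_joint_accumulation_points u v :
  finite_set (accumulation_points u) -> finite_set (accumulation_points v) ->
  finite_set (joint_accumulation_points u v).
Proof.
move=> fu fv; apply: sub_finite_set (finite_setX fu fv) => p [U [UU ooU up vp]].
by split; apply/accumulation_pointsP; exists U.
Qed.

End AccumulationPoints.

(** * From a plane of sequences to a finite planar set *)

Lemma lin_indep_card2 (F : fieldType) (X : lmodType F) (B : set X) :
  lin_indep B -> B #= `I_2 -> exists u v : X,
    forall c d : F, lin_span B (c *: u + d *: v) /\
      (c *: u + d *: v = 0 -> c = 0 /\ d = 0).
Proof.
move=> Bfree B2.
have [s BE] : exists s : seq X, B = [set` s].
  by apply/finite_seqP; apply/finite_setP; exists 2%N.
have := card_eq_seq_undup (s := s); rewrite -BE => /(_ _ B2).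
have : B = [set` undup s].
  by rewrite BE; apply/seteqP; split => x /=; rewrite mem_undup.
have := undup_uniq s; case: (undup s) => [|u [|v []]] // uv {}BE _.
have nvu : (v == u) = false.
  by move: uv; rewrite /= inE andbT eq_sym => /negPf.
exists u, v => c d; pose f w := if w == u then c else d.
have fE : \sum_(w <- [:: u; v]) f w *: w = c *: u + d *: v.
  by rewrite big_cons big_seq1 /f eqxx nvu.
split; first by exists [:: u; v], f; rewrite fE BE; split.
move=> cd0; have f0 : {in [:: u; v], forall w, f w = 0}.
  by apply: Bfree => //; rewrite ?BE ?fE.
have := f0 u; have := f0 v; rewrite /f eqxx nvu !inE !eqxx orbT.
by move=> -> // ->.
Qed.

Theorem corollary5p8 (R : realType) (a : nat -> nat)
  (a_incr : forall m n : nat, (m < n)%N -> (a m < a n)%N)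
  (a0_ge2 : (2 <= a 0)%N)
  (a_gap : forall n : nat, (2 * a n < a n.+1)%N) :
  ~ lineable `I_2 (\bigcup_(n in [set: nat]) Lcard R `I_(a n)).
Proof.
move=> [V [_ [B [Bfree BV B2]] VM]].
have [u [v uv]] := lin_indep_card2 Bfree B2.
(* Independence excludes the zero vector, the only element of [V] allowed outside the union. *)
have L c d : (c != 0) || (d != 0) ->
    exists n, accumulation_points (c *: u + d *: v) #= `I_(a n).
  move=> cd; have [+ indep] := uv c d.
  rewrite BV => /VM[[n _ Ln]|/indep[c0 d0]]; first by exists n.
  by rewrite c0 d0 eqxx in cd.
have fin c d : (c != 0) || (d != 0) ->
    finite_set (accumulation_points (c *: u + d *: v)).
  by move=> /L[n Ln]; apply/finite_setP; exists (a n).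
have /finite_seqP[s sE] : finite_set (joint_accumulation_points u v).
  apply: finite_joint_accumulation_points.
    by have := fin 1 0; rewrite oner_neq0 scale1r scale0r addr0; apply.
  by have := fin 0 1; rewrite oner_neq0 orbT scale1r scale0r add0r; apply.
apply: (no_planar_gap_spectrum a_incr a0_ge2 a_gap (undup_uniq s)) => c d.
move=> /L[n]; rewrite accumulation_points_lincomb sE => sn; exists n.
apply: card_eq_seq_undup; congr (_ #= _) : sn.
apply/seteqP; split => [x [p ps <-]|x /mapP[p]] /=.
  by apply/mapP; exists p; rewrite // mem_undup.
by rewrite mem_undup => ps ->; exists p.
Qed.
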